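(* Let $K$ be a field and $S=K[x_1,\ldots,x_n]$. If $I\subset S$ is a monomial ideal with linear quotients, then $I$ is componentwise linear.
   Context: For a monomial ideal $I$, $G(I)$ denotes its unique minimal set of monomial generators. $I$ has linear quotients if there is an ordering $u_1,\ldots,u_m$ of $G(I)$ such that for each $i=2,\ldots,m$ the colon ideal $(u_1,\ldots,u_{i-1}):u_i$ is generated by a subset of the variables $\{x_1,\ldots,x_n\}$. $I_{\langle a\rangle}$ denotes the ideal of $S$ generated by the degree-$a$ graded component of $I$. $I$ is componentwise linear if for every $a$ the ideal $I_{\langle a\rangle}$ (when nonzero) has a linear resolution, i.e. a minimal graded free $S$-resolution in which the $i$-th free module is generated in degree $a+i$ for all $i\ge 0$. *)

(* Defs.v *)
From HB Require Import structures.
From mathcomp Require Import all_boot all_order all_algebra.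
From mathcomp Require Import mpoly.

Set Implicit Arguments.
Unset Strict Implicit.
Unset Printing Implicit Defensive.

Import GRing.Theory.
Local Open Scope ring_scope.

(* Subsets of S = K[x_1, ..., x_n], ideals in particular, are Prop-valued
   predicates on {mpoly K[n]}, compared extensionally. *)
Section Ideals.

Variables (K : fieldType) (n : nat).
Local Notation S := {mpoly K[n]}.
Implicit Types (A I J : S -> Prop) (M : 'X_{1..n} -> Prop).

Definition same_set A B := forall p : S, A p <-> B p.

Definition ideal_gen A : S -> Prop := fun p =>
  exists (m : nat) (c g : 'I_m -> S),
    (forall i, A (g i)) /\ p = \sum_(i < m) c i * g i.

Definition monomial_gen M : S -> Prop :=
  ideal_gen (fun q => exists2 u, M u & q = 'X_[u]).

Definition monomial_ideal I := exists M, same_set I (monomial_gen M).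

Definition var_ideal (V : {set 'I_n}) : S -> Prop :=
  ideal_gen (fun q => exists2 k, k \in V & q = 'X_k).

Definition colon I (f : S) : S -> Prop := fun p => I (p * f).

(* s is an enumeration without repetition of G(I). *)
Definition minimal_generators I (s : seq 'X_{1..n}) :=
  [/\ uniq s,
      same_set I (monomial_gen (fun u => u \in s))
    & forall t : seq 'X_{1..n}, {subset t <= s} ->
        same_set I (monomial_gen (fun u => u \in t)) -> {subset s <= t}].

Definition linear_quotients I :=
  exists2 s, minimal_generators I s &
    forall i, (0 < i < size s)%N ->
      exists V : {set 'I_n},
        same_set (colon (monomial_gen (fun u => u \in take i s))
                        'X_[nth 0%MM s i])
                 (var_ideal V).

Definition component_ideal I (d : nat) : S -> Prop :=
  ideal_gen (fun q => I q /\ q \is d.-homog).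

(* ... -> F_1 -> F_0 -> J -> 0 with F_i = \bigoplus_k S(- gfr_deg i k), where k
   ranges over 'I_(gfr_rank i). Elements of F_i are row vectors, and maps act
   by right multiplication: row j of gfr_diff i is the image in F_i of the j-th
   basis element of F_(i+1). All maps are homogeneous of degree 0. *)
Record graded_free_resolution J := GradedFreeResolution {
  gfr_rank : nat -> nat;
  gfr_deg : forall i, 'I_(gfr_rank i) -> nat;
  gfr_diff : forall i, 'M[S]_(gfr_rank i.+1, gfr_rank i);
  gfr_aug : 'cV[S]_(gfr_rank 0);
  gfr_aug_homog : forall k, gfr_aug k 0 \is (gfr_deg k).-homog;
  gfr_diff_homog : forall i j k,
    gfr_diff i j k = 0 \/
    exists2 e, gfr_deg j = (gfr_deg k + e)%N & gfr_diff i j k \is e.-homog;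
  gfr_aug_image : forall p,
    J p <-> exists v : 'rV[S]_(gfr_rank 0), (v *m gfr_aug) 0 0 = p;
  gfr_exact0 : forall v : 'rV[S]_(gfr_rank 0),
    v *m gfr_aug = 0 <-> exists w, w *m gfr_diff 0 = v;
  gfr_exact : forall i (v : 'rV[S]_(gfr_rank i.+1)),
    v *m gfr_diff i = 0 <-> exists w, w *m gfr_diff i.+1 = v
}.

(* The differentials have their images in (x_1, ..., x_n) F_i. *)
Definition minimal_resolution J (F : graded_free_resolution J) :=
  forall i j k, var_ideal [set: 'I_n] (gfr_diff F i j k).

Definition linear_resolution (a : nat) J :=
  exists2 F : graded_free_resolution J, minimal_resolution F &
    forall i (k : 'I_(gfr_rank F i)), gfr_deg k = (a + i)%N.

Definition componentwise_linear I :=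
  forall a : nat, (exists2 p, component_ideal I a p & p != 0) ->
    linear_resolution a (component_ideal I a).

End Ideals.

(* Main.v *)
(* Having a linear resolution with generators in a fixed degree passes to
   extensions (horseshoe lemma), so it suffices to filter I_<a>. With
   G(I) = u_1, ..., u_m in the given order, let P_i be spanned by the monomials
   of degree at least a divisible by some u_j with j <= i and deg u_j <= a. If
   V_i is the set of variables generating (u_1, ..., u_(i-1)) : u_i, then
   P_i / P_(i-1) is either 0 or the truncation of S/(V_i)(-deg u_i) in degrees
   at least a. The truncations of S/(V) in degrees at least b are treated by
   induction on b and on the number of variables outside V, through
   0 -> (S/(V))_(>= b)(-1) -> (S/(V))_(>= b+1) -> (S/(V, x))_(>= b+1) -> 0,
   where the first map is the multiplication by x; the base case S/(V) is
   obtained by adding one variable at a time. *)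
Require Import Defs.
From HB Require Import structures.
From mathcomp Require Import all_boot all_order all_algebra.
From mathcomp Require Import mpoly.
From Stdlib Require IndefiniteDescription.

Set Implicit Arguments.
Unset Strict Implicit.
Unset Printing Implicit Defensive.

Import GRing.Theory.
Local Open Scope ring_scope.

(** * Homogeneous components, graded submodules and generated ideals *)

Section LinearSyzygies.

Variables (K : fieldType) (n : nat).
Local Notation S := {mpoly K[n]}.

Lemma pihomogM d e (p q : S) : q \is e.-homog ->
  pihomog mdeg (d + e) (p * q) = pihomog mdeg d p * q.
Proof.
move=> hq; rewrite {1}[p]mpolyE mulr_suml linear_sum /= [in RHS]pihomogE.
rewrite mulr_suml [RHS]big_mkcond; apply: eq_bigr => m _.
rewrite -mul_mpolyC -mulrA mul_mpolyC linearZ /=.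
have hX : 'X_[m] * q \is (mdeg m + e).-homog.
  by apply: dhomogM => //; rewrite dhomogX.
case: eqP => [<-|/eqP ne]; first by rewrite pihomog_dE.
by rewrite (pihomog_ne0 _ hX) ?scaler0 ?eqn_add2r.
Qed.

Lemma pihomog_mulmx d e s t (v : 'rV[S]_t) (g : 'M[S]_(t, s)) :
  (forall i j, g i j \is e.-homog) ->
  map_mx (pihomog mdeg (d + e)) (v *m g) = map_mx (pihomog mdeg d) v *m g.
Proof.
move=> hg; apply/matrixP=> i j; rewrite !mxE linear_sum /=.
by apply: eq_bigr => k _; rewrite mxE pihomogM.
Qed.

(** The basis of the free module sits in degree 0, so homogeneous components are taken entrywise. *)
Definition graded_submodule s (Z : 'rV[S]_s -> Prop) :=
  [/\ Z 0, forall c v w, Z v -> Z w -> Z (c *: v + w)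
    & forall d v, Z v -> Z (map_mx (pihomog mdeg d) v)].

Lemma graded_kernel d s t (g : 'M[S]_(t, s)) :
  (forall i j, g i j \is d.-homog) ->
  graded_submodule (fun v : 'rV[S]_t => v *m g = 0).
Proof.
move=> hg; split=> [|c v w vg wg|e v vg]; first exact: mul0mx.
  by rewrite mulmxDl -scalemxAl vg wg scaler0 addr0.
rewrite -(pihomog_mulmx _ _ hg) vg.
by apply/matrixP=> i j; rewrite !mxE linear0.
Qed.

Lemma ideal_gen0 (A : S -> Prop) : ideal_gen A 0.
Proof.
by exists 0%N, (fun=> 0), (fun=> 0); rewrite big_ord0; split=> [[]|].
Qed.

Lemma ideal_genD (A : S -> Prop) p q :
  ideal_gen A p -> ideal_gen A q -> ideal_gen A (p + q).
Proof.
move=> [k [c [g [Ag ->]]]] [l [d [h [Ah ->]]]].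
pose join (f : 'I_k -> S) (f' : 'I_l -> S) i :=
  match split i with inl j => f j | inr j => f' j end.
exists (k + l)%N, (join c d), (join g h); split=> [i|].
  by rewrite /join; case: split.
rewrite big_split_ord /=; congr (_ + _); apply: eq_bigr => i _; rewrite /join.
  by rewrite (unsplitK (inl i)).
by rewrite (unsplitK (inr i)).
Qed.

Lemma mem_ideal_gen (A : S -> Prop) c g : A g -> ideal_gen A (c * g).
Proof.
by move=> Ag; exists 1%N, (fun=> c), (fun=> g); rewrite big_ord1.
Qed.

Lemma ideal_gen_sub (A B : S -> Prop) : B 0 ->
  (forall p q, B p -> B q -> B (p + q)) -> (forall c g, A g -> B (c * g)) ->
  forall p, ideal_gen A p -> B p.
Proof.
move=> B0 BD AB p [k [c [g [Ag ->]]]].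
by elim/big_rec: _ => // i q _; apply/BD/AB.
Qed.

(** This is what makes a resolution with linear differentials minimal. *)
Lemma linear_form_var_ideal (p : S) :
  p \is 1.-homog -> var_ideal [set: 'I_n] p.
Proof.
move=> hp; rewrite [p]mpolyE big_seq.
elim/big_rec: _ => [|m q /(dhomog_mf hp)/eqP/mdeg1P[k /eqP->]].
  exact: ideal_gen0.
by apply: ideal_genD; rewrite -mul_mpolyC; apply: mem_ideal_gen; exists k.
Qed.

(** * Coinductive linear resolutions and their extensions *)

(* [lin Z]: the submodule [Z] of a free module with basis in degree 0 has a
   linear resolution with generators in degree 1. *)
CoInductive lin s (Z : 'rV[S]_s -> Prop) : Prop :=
  LinStep t (g : 'M[S]_(t, s)) of
    (forall i j, g i j \is 1.-homog) &
    (forall v, Z v <-> exists w, w *m g = v) &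
    lin (fun w : 'rV[S]_t => w *m g = 0).

(** Guardedness is settled here once: afterwards it suffices to exhibit a property of submodules
    that passes to the syzygies of some linear generators. *)
Lemma lin_coind (Phi : forall s, ('rV[S]_s -> Prop) -> Prop) :
  (forall s Z, Phi s Z -> exists t (g : 'M[S]_(t, s)),
     [/\ forall i j, g i j \is 1.-homog,
         forall v, Z v <-> exists w, w *m g = v
       & Phi t (fun w => w *m g = 0)]) ->
  forall s Z, Phi s Z -> lin Z.
Proof.
move=> step; cofix IH => s Z /step[t [g [hg gZ kg]]].
exact: (LinStep hg gZ (IH _ _ kg)).
Qed.

Lemma eq_lin s (Y Z : 'rV[S]_s -> Prop) :
  (forall v, Y v <-> Z v) -> lin Y -> lin Z.
Proof.
move=> YZ [t g hg gY kg]; apply: LinStep hg _ kg => v.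
by rewrite -gY; split=> /YZ.
Qed.

Lemma lin0 s (Z : 'rV[S]_s -> Prop) : (forall v, Z v <-> v = 0) -> lin Z.
Proof.
move: s Z; apply: lin_coind => s Z Z0; exists 0%N, 0; split=> [[]//|v|v].
  by rewrite Z0; split=> [->|[w <-]]; [exists 0|]; rewrite mulmx0.
by rewrite mulmx0 [v]thinmx0.
Qed.

(** The rank is an index, which gives [lin_ext] the shape needed by [lin_coind] while its splitting
    as a sum changes from stage to stage. *)
Inductive lin_ext : forall s, ('rV[S]_s -> Prop) -> Prop :=
  LinExt s1 s2 (Z : 'rV[S]_(s1 + s2) -> Prop) of
    graded_submodule Z &
    lin (fun u => Z (row_mx u 0)) &
    lin (fun v => exists u, Z (row_mx u v)) :
  lin_ext Z.

(* Horseshoe lemma: stacking generators of the two ends, the syzygies are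
   again such an extension, so that the argument repeats. *)
Lemma lin_extension s1 s2 (Z : 'rV[S]_(s1 + s2) -> Prop) :
  graded_submodule Z ->
  lin (fun u => Z (row_mx u 0)) ->
  lin (fun v => exists u, Z (row_mx u v)) -> lin Z.
Proof.
move=> grZ lin1 lin2; have: lin_ext Z by exact: LinExt.
move: {s1 s2}(s1 + s2)%N Z {grZ lin1 lin2}; apply: lin_coind => s Z.
case=> {s Z} s1 s2 Z [Z0 Zlin Zgr] [t1 g1 hg1 gZ1 kg1] [t2 g2 hg2 gZ2 kg2].
(* Lift each generator of the quotient to [Z]. Taking the degree 1 component keeps [row i g2],
   already linear, and makes the added part [u] linear too. *)
have lift i : exists u, Z (row_mx u (row i g2)) /\ forall j, u 0 j \is 1.-homog.
  have /gZ2[u Zu] : exists w, w *m g2 = row i g2.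
    by exists (delta_mx 0 i); rewrite -rowE.
  exists (map_mx (pihomog mdeg 1) u); split=> [|j]; last first.
    by rewrite mxE pihomogP.
  have := Zgr 1%N _ Zu; rewrite map_row_mx; congr (Z (row_mx _ _)).
  by apply/rowP=> j; rewrite !mxE pihomog_dE.
have [f fP] := fin_all_exists lift.
pose h : 'M[S]_(t2, s1) := \matrix_(i, j) f i 0 j.
have Zh i : Z (row_mx (row i h) (row i g2)).
  have [+ _] := fP i; congr (Z (row_mx _ _)).
  by apply/rowP=> j; rewrite !mxE.
have hZ (c : 'rV_t2) : Z (row_mx (c *m h) (c *m g2)).
  rewrite -mul_mx_row mulmx_sum_row.
  elim/big_rec: _ => // i v _ Zv; apply: Zlin => //.
  by rewrite row_row_mx.
have ZB u v : Z u -> Z v -> Z (u - v).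
  by move=> Zu Zv; rewrite addrC -scaleN1r; apply: Zlin.
have hg i j : (block_mx g1 0 h g2) i j \is 1.-homog.
  rewrite !mxE; case: splitP => k _; rewrite !mxE; case: splitP => l _ //.
  - by rewrite mxE dhomog0.
  - by rewrite mxE; have [_] := fP k.
exists (t1 + t2)%N, (block_mx g1 0 h g2); split=> //.
  move=> v; rewrite -[v]hsubmxK; split.
    move=> Zv; have /gZ2[c cE] : exists u, Z (row_mx u (rsubmx v)).
      by exists (lsubmx v).
    have := ZB _ _ Zv (hZ c).
    rewrite opp_row_mx add_row_mx cE subrr => /gZ1[b bE].
    exists (row_mx b c); rewrite mul_row_block mulmx0 add0r cE bE.
    by rewrite subrK.
  case=> w <-; rewrite -[w]hsubmxK mul_row_block mulmx0 add0r.
  set b := lsubmx w; set c := rsubmx w.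
  have /gZ1 Zb : exists w, w *m g1 = b *m g1 by exists b.
  rewrite -[X in row_mx _ X]add0r -add_row_mx -[X in Z (X + _)]scale1r.
  exact: Zlin.
apply: LinExt; first exact: graded_kernel hg.
  apply: eq_lin kg1 => u.
  rewrite mul_row_block !mul0mx !addr0 mulmx0.
  by split=> [->|]; [rewrite row_mx0|rewrite -[RHS]row_mx0 => /eq_row_mx[]].
(* Syzygies of [g2] lift: if [c *m g2 = 0], then [c *m h] is a combination [b *m g1], and
   [row_mx (- b) c] is a syzygy of the whole block. *)
apply: eq_lin kg2 => c; split=> [cg2|[b]].
  have := hZ c; rewrite cg2 => /gZ1[b bE].
  exists (- b).
  by rewrite mul_row_block mulmx0 mulNmx bE addNr cg2 addr0 row_mx0.
by rewrite mul_row_block mulmx0 add0r -[RHS]row_mx0 => /eq_row_mx[].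
Qed.

(** * Linear resolutions of quotients of ideals *)

(* [linq d P Q]: the module [P / Q] has a linear resolution with generators in
   degree [d]. *)
Definition linq d (P Q : S -> Prop) :=
  exists t (g : 'cV[S]_t),
    [/\ forall i j, g i j \is d.-homog,
        forall p, P p <-> exists c : 'rV_t, Q (p - (c *m g) 0 0)
      & lin (fun c : 'rV_t => Q ((c *m g) 0 0))].

Definition graded_ideal (Q : S -> Prop) :=
  [/\ Q 0, forall c p q, Q p -> Q q -> Q (c * p + q)
    & forall d p, Q p -> Q (pihomog mdeg d p)].

(** The relations modulo [Q] among the stacked generators form an extension of the relations of
    [P / P'] by those of [P' / Q]. *)
Lemma linq_trans d (P P' Q : S -> Prop) : graded_ideal Q ->
  linq d P' Q -> linq d P P' -> linq d P Q.
Proof.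
move=> [Q0 Qlin Qgr] [t1 [g1 [hg1 P'E lin1]]] [t2 [g2 [hg2 PE lin2]]].
have hg i j : (col_mx g1 g2) i j \is d.-homog.
  by rewrite !mxE; case: splitP => k _; rewrite ord1.
exists (t1 + t2)%N, (col_mx g1 g2); split=> [//|p|].
  rewrite PE; split=> [[c2 /P'E[c1 Qp]]|[c Qp]].
    exists (row_mx c1 c2); rewrite mul_row_col mxE addrC opprD addrA.
    exact: Qp.
  exists (rsubmx c); rewrite P'E; exists (lsubmx c).
  by move: Qp; rewrite -{1}[c]hsubmxK mul_row_col mxE addrC opprD addrA addrAC
    [X in Q X]addrC addrA.
apply: lin_extension.
- split=> [|c v w Qv Qw|e v Qv]; first by rewrite mul0mx mxE.
    by rewrite mulmxDl -scalemxAl !mxE in Qv Qw *; apply: Qlin.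
  by rewrite -(pihomog_mulmx _ _ hg) mxE; apply: Qgr.
- by apply: eq_lin lin1 => c; rewrite mul_row_col mul0mx addr0.
apply: eq_lin lin2 => c; rewrite P'E; split=> [[b Qb]|[b Qb]].
  exists (- b); rewrite mul_row_col mulNmx !mxE addrC.
  by move: Qb; rewrite !mxE.
exists (- b); move: Qb; rewrite mul_row_col mulNmx !mxE opprK.
by rewrite addrC.
Qed.

Lemma linq_refl d (Q : S -> Prop) : Q 0 -> linq d Q Q.
Proof.
move=> Q0; exists 0%N, 0; split=> [[]//|p|].
  by split=> [Qp|[c]]; [exists 0|]; rewrite mulmx0 mxE subr0.
by apply: lin0 => v; rewrite mulmx0 mxE [v]thinmx0.
Qed.

Lemma eq_linq d (P P' Q Q' : S -> Prop) :
  same_set P P' -> same_set Q Q' -> linq d P Q -> linq d P' Q'.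
Proof.
move=> eP eQ [t [g [hg PE lg]]]; exists t, g; split=> [//|p|].
  by rewrite -eP PE; split=> -[c /eQ]; exists c.
by apply: eq_lin lg => c; apply: eQ.
Qed.

(** Multiplication by [f] identifies [P / Q], shifted by [e], with [P2 / Q2], so the generators
    [f *: g] have the same relations as [g]. *)
Lemma linq_shift d e f (P Q P2 Q2 : S -> Prop) :
  graded_ideal Q2 -> f \is e.-homog ->
  (forall p, Q p <-> Q2 (f * p)) ->
  (forall p, P2 p <-> exists2 q, P q & Q2 (p - f * q)) ->
  linq d P Q -> linq (e + d) P2 Q2.
Proof.
move=> [Q20 Q2lin Q2gr] hf QE P2E [t [g [hg PE lg]]].
have fg (c : 'rV_t) : (c *m (f *: g)) 0 0 = f * (c *m g) 0 0.
  by rewrite -scalemxAr mxE.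
exists t, (f *: g); split=> [i j|p|].
- by rewrite mxE; apply: dhomogM.
- rewrite P2E; split=> [[q /PE[c Qqc] Q2p]|[c]].
    exists c; rewrite fg; move/QE: Qqc => /(Q2lin 1 _ _)/(_ Q2p).
    by rewrite mul1r mulrBr addrC addrA subrK.
  rewrite fg => Q2p; exists ((c *m g) 0 0) => //.
  by apply/PE; exists c; rewrite subrr; apply/QE; rewrite mulr0.
by apply: eq_lin lg => c; rewrite fg QE.
Qed.

(** The generator 1 of [S / Q] has [Q] as its module of relations, so a resolution of [Q] is
    prolonged by one step. *)
Lemma linq_quotient (Q : S -> Prop) :
  linq 1 Q (eq^~ 0) -> linq 0 (fun=> True) Q.
Proof.
move=> [t [g [hg QE lg]]]; exists 1%N, 1%:M; split=> [i j|p|].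
- by rewrite !ord1 mxE dhomog1.
- split=> // _; exists p%:M; rewrite mulmx1 mxE subrr.
  by apply/QE; exists 0; rewrite mul0mx mxE subrr.
apply: LinStep hg _ (eq_lin _ lg) => v; last first.
  split=> [vg|->]; last by rewrite mxE.
  by apply/rowP=> j; rewrite ord1 vg mxE.
rewrite mulmx1 QE; split=> -[c E]; exists c; last by rewrite E subrr.
by apply/rowP=> j; rewrite ord1; apply/esym/eqP; rewrite -subr_eq0 E.
Qed.

(** * From coinductive linearity to a graded free resolution *)

Record lin_step s (Z : 'rV[S]_s -> Prop) := {
  step_rank : nat;
  step_mx : 'M[S]_(step_rank, s);
  step_homog : forall i j, step_mx i j \is 1.-homog;
  step_gen : forall v, Z v <-> exists w, w *m step_mx = v;
  step_lin : lin (fun w => w *m step_mx = 0) }.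

(** [lin] is a proposition, whereas a resolution stores ranks and matrices as data; a choice
    principle bridges the two. *)
Definition choose_step s (Z : 'rV[S]_s -> Prop) (linZ : lin Z) : lin_step Z :=
  proj1_sig (IndefiniteDescription.constructive_indefinite_description
    (fun _ => True)
    (let: LinStep _ _ h gen k := linZ in
     ex_intro _ (Build_lin_step h gen k) I)).

Record lin_state := LinState {
  state_rank : nat;
  state_sub : 'rV[S]_state_rank -> Prop;
  state_lin : lin state_sub }.

Definition next_state (st : lin_state) : lin_state :=
  LinState (step_lin (choose_step (state_lin st))).

Lemma linq_linear_resolution a (J : S -> Prop) :
  linq a J (eq^~ 0) -> linear_resolution a J.
Proof.
move=> [t [g [hg JE lg]]].
pose st i := iter i next_state (LinState lg).
pose diff i := choose_step (state_lin (st i)).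
pose rk i := state_rank (st i).
pose d i : 'M[S]_(rk i.+1, rk i) := step_mx (diff i).
have hd i j k : d i j k \is 1.-homog by apply: step_homog.
(* By computation, the submodule held by state [i.+1] is the kernel of [d i]. *)
have exact i (v : 'rV[S]_(rk i.+1)) :
    v *m d i = 0 <-> exists w, w *m d i.+1 = v.
  exact: (step_gen (diff i.+1)).
have exact0 (v : 'rV[S]_(rk 0%N)) : v *m g = 0 <-> exists w, w *m d 0%N = v.
  rewrite -(step_gen (diff 0%N)) /=; split=> [->|E]; first by rewrite mxE.
  by apply/rowP=> j; rewrite ord1 E mxE.
have image p : J p <-> exists v : 'rV[S]_(rk 0%N), (v *m g) 0 0 = p.
  rewrite JE; split=> -[c E]; exists c; last by rewrite E subrr.
  by apply/esym/eqP; rewrite -subr_eq0 E.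
have hdiff i j k : d i j k = 0 \/
    exists2 e, (a + i.+1 = a + i + e)%N & d i j k \is e.-homog.
  by right; exists 1%N; rewrite // addn1 addnS.
have haug k : g k 0 \is (a + 0).-homog by rewrite addn0.
exists (@GradedFreeResolution _ _ J rk (fun i _ => (a + i)%N) d g
         haug hdiff image exact0 exact) => // i j k.
exact: linear_form_var_ideal.
Qed.

End LinearSyzygies.

(** * Monomial ideals as sets of exponents *)

Section MonomialIdeals.

Variables (K : fieldType) (n : nat).
Local Notation S := {mpoly K[n]}.
Local Notation mon := 'X_{1..n}.
Implicit Types (U W : pred mon) (p q : S).

Lemma lem_mdeg (m m' : mon) : (m <= m')%MM -> (mdeg m <= mdeg m')%N.
Proof. by move/submK <-; rewrite mdegD leq_addl. Qed.

(** An ideal when [U] is an [upset]; inclusions and colons by monomials then become boolean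
    conditions on exponents. *)
Definition mon_ideal U p := {subset msupp p <= U}.

Definition upset U := forall m m' : mon, (m <= m')%MM -> U m -> U m'.

Lemma mon_ideal0 U : mon_ideal U 0.
Proof. by move=> m; rewrite msupp0. Qed.

Lemma mon_ideal_pred0 p : mon_ideal pred0 p <-> p = 0.
Proof.
split=> [p0|->]; last exact: mon_ideal0.
apply: msuppnil0; case E: (msupp p) => [//|m l].
by have := p0 m; rewrite E mem_head => /(_ isT).
Qed.

Lemma mon_idealD U p q : mon_ideal U p -> mon_ideal U q -> mon_ideal U (p + q).
Proof.
move=> Up Uq m /msuppD_le; rewrite mem_cat => /orP[]; [exact: Up|exact: Uq].
Qed.

Lemma mon_idealM U c p : upset U -> mon_ideal U p -> mon_ideal U (c * p).
Proof.
move=> upU Up m /msuppM_le /allpairsP[[m1 m2] /= [_ m2p ->]].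
by apply: upU (Up _ m2p); rewrite lem_addl.
Qed.

Lemma mon_idealX U m : mon_ideal U 'X_[m] <-> U m.
Proof.
split=> [/(_ m)|Um m']; rewrite msuppX inE; first by rewrite eqxx => /(_ isT).
by move=> /eqP->.
Qed.

Lemma mon_idealMX U u p :
  mon_ideal U ('X_[u] * p) <-> mon_ideal (fun m => U (u + m)%MM) p.
Proof.
split=> Up m; rewrite mulrC in Up *.
  by move=> mp; apply: Up; rewrite (perm_mem (msuppMX _ _)) map_f.
by rewrite (perm_mem (msuppMX _ _)) => /mapP[m' m'p ->]; apply: Up.
Qed.

Lemma mon_ideal_ind U (A : S -> Prop) : A 0 ->
  (forall p q, A p -> A q -> A (p + q)) ->
  (forall c m, U m -> A (c *: 'X_[m])) ->
  forall p, mon_ideal U p -> A p.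
Proof.
move=> A0 AD AX p Up; rewrite [p]mpolyE big_seq.
by elim/big_rec: _ => // m q mp; apply: AD; apply/AX/Up.
Qed.

Lemma graded_mon_ideal U : upset U -> graded_ideal (mon_ideal U).
Proof.
move=> upU; split=> [|c p q Up Uq|d p Up]; first exact: mon_ideal0.
  by apply: mon_idealD => //; apply: mon_idealM.
rewrite pihomogE big_seq_cond; elim/big_rec: _ => [|m q /andP[mp _] Uq].
  exact: mon_ideal0.
apply: mon_idealD => //; rewrite -mul_mpolyC; apply: mon_idealM => //.
by apply/mon_idealX/Up.
Qed.

Definition linq_mon d U W := linq d (mon_ideal U) (mon_ideal W).

Lemma linq_mon_refl d U : linq_mon d U U.
Proof. exact/linq_refl/mon_ideal0. Qed.

Lemma eq_linq_mon d U U' W W' :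
  U =1 U' -> W =1 W' -> linq_mon d U W -> linq_mon d U' W'.
Proof.
move=> eU eW; apply: eq_linq => p; split=> sp m /sp; rewrite /in_mem /=.
- by rewrite eU.
- by rewrite eU.
- by rewrite eW.
- by rewrite eW.
Qed.

Lemma linq_mon_trans d U U' W : upset W ->
  linq_mon d U' W -> linq_mon d U U' -> linq_mon d U W.
Proof. by move=> upW; apply: linq_trans; apply: graded_mon_ideal. Qed.

Lemma linq_mon_shift d u U W U2 W2 : upset W2 ->
  (forall m, W m = W2 (u + m)%MM) ->
  (forall m, U2 m = W2 m || (u <= m)%MM && U (m - u)%MM) ->
  linq_mon d U W -> linq_mon (mdeg u + d) U2 W2.
Proof.
move=> upW2 WE U2E; have [_ lW2 _] := graded_mon_ideal upW2.
apply: (@linq_shift _ _ _ _ 'X_[u]); [exact: graded_mon_ideal| | |].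
- by rewrite dhomogX.
- move=> p; rewrite mon_idealMX; split=> Wp m /Wp; rewrite /in_mem /=.
    by rewrite WE.
  by rewrite WE.
move=> p; split=> [|[q Uq W2p]]; last first.
  rewrite -[p](subrK ('X_[u] * q)); apply: mon_idealD.
    by move=> m /W2p; rewrite /in_mem /= U2E => ->.
  rewrite mon_idealMX => m /Uq; rewrite /in_mem /= U2E => Um.
  by rewrite lem_addr addmC addmK Um orbT.
move: p; apply: mon_ideal_ind.
- by exists 0; [exact: mon_ideal0 | rewrite mulr0 subr0; exact: mon_ideal0].
- move=> p1 p2 [q1 Uq1 W1] [q2 Uq2 W2']; exists (q1 + q2).
    exact: mon_idealD.
  by rewrite mulrDr opprD addrACA; apply: mon_idealD.
(* A monomial in [W2] is represented by 0, any other one by its quotient by ['X_[u]]. *)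
move=> c m; rewrite U2E; case: (boolP (W2 m)) => /= [Wm _|_ /andP[um Um]].
  exists 0; first exact: mon_ideal0.
  rewrite mulr0 subr0 -mul_mpolyC; apply: mon_idealM => //.
  exact/mon_idealX.
exists (c *: 'X_[m - u]).
  by move=> m' /msuppZ_le; rewrite msuppX inE => /eqP->.
rewrite -scalerAr -mpolyXD addmC submK // subrr; exact: mon_ideal0.
Qed.

(** * Quotients by variables and their truncations *)

Definition var_up (V : {set 'I_n}) : pred mon :=
  fun m => [exists k in V, (U_(k) <= m)%MM].

Lemma upset_var_up V : upset (var_up V).
Proof.
move=> m m' mm' /exists_inP[k kV km]; apply/exists_inP; exists k => //.
exact: lepm_trans km mm'.
Qed.

Lemma upset_mdeg b U : upset U -> upset (fun m => (b <= mdeg m)%N && U m).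
Proof.
move=> upU m m' mm' /andP[bm Um]; rewrite (upU _ _ mm' Um) andbT.
exact: leq_trans bm (lem_mdeg mm').
Qed.

Lemma var_upU1 x (V : {set 'I_n}) m :
  var_up (x |: V) m = var_up V m || (U_(x) <= m)%MM.
Proof.
apply/exists_inP/orP=> [[k]|[/exists_inP[k kV km]|xm]].
- rewrite in_setU1 => /orP[/eqP->|kV] km; [by right|left].
  by apply/exists_inP; exists k.
- by exists k; rewrite // in_setU1 kV orbT.
- by exists x; rewrite // setU11.
Qed.

(** On exponents: [x] is a nonzerodivisor modulo variables different from it. *)
Lemma var_up_addl x (V : {set 'I_n}) m :
  x \notin V -> var_up V (U_(x) + m)%MM = var_up V m.
Proof.
move=> xV; apply: eq_existsb => k; rewrite !lep1mP mnmDE mnm1E.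
case: (x =P k) => [<-|//].
by rewrite (negbTE xV).
Qed.

Lemma linq_mon_setT U : linq_mon 1 U pred0 -> linq_mon 0 predT U.
Proof.
move=> lU; apply: (@eq_linq _ _ _ (fun=> True) _ (mon_ideal U)) => //.
by apply: linq_quotient; apply: eq_linq lU => // p; apply: mon_ideal_pred0.
Qed.

(** For [x] in [V], the quotient of (V) by (V - x) is S/(V - x) shifted by [x], and the latter is
    resolved through the induction hypothesis. *)
Lemma linq_variables V : linq_mon 1 (var_up V) pred0.
Proof.
have [k] := ubnP #|V|; elim: k V => // k IH V ltV.
have [->|[x xV]] := set_0Vmem V.
  apply: eq_linq_mon (linq_mon_refl 1 pred0) => // m.
  by apply/esym/exists_inP=> -[x]; rewrite inE.
rewrite -(setD1K xV); have lVx : linq_mon 1 (var_up (V :\ x)) pred0.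
  by apply: IH; rewrite (cardsD1 x V) xV in ltV.
apply: (linq_mon_trans _ lVx) => //.
rewrite -[1%N]/(1 + 0)%N -(mdeg1 x).
apply: linq_mon_shift (linq_mon_setT lVx) => [|m|m].
- exact: upset_var_up.
- by rewrite var_up_addl // setD11.
- by rewrite var_upU1 andbT.
Qed.

(* The module is the truncation of [S / (V)] in degrees at least [b]. *)
Lemma linq_mdeg b V :
  linq_mon b (fun m => b <= mdeg m)%N (fun m => (b <= mdeg m)%N && var_up V m).
Proof.
elim: b V => [|b IHb] V.
  apply: eq_linq_mon (linq_mon_setT (linq_variables V)) => // m.
have [k] := ubnP #|~: V|; elim: k V => // k IH V ltV.
have [V0|[x]] := set_0Vmem (~: V).
  (* All variables are in [V], so every monomial of positive degree lies in (V) and the module is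
     zero. *)
  apply: eq_linq_mon (linq_mon_refl _ (fun m => b < mdeg m)%N) => // m.
  case: ltnP => //= bm; apply/esym/exists_inP.
  have /existsP[x mx] : [exists x, m x != 0%N].
    apply: contraTT bm; rewrite negb_exists => /forallP m0.
    by rewrite mdegE big1 // => i _; apply/eqP; have:= m0 i; rewrite negbK.
  by exists x; rewrite ?lep1mP //; apply: contraFT (in_set0 x); rewrite -V0 inE.
rewrite inE => xV.
(* The submodule cut out by [x |: V] comes from the bound [b] with the same [V]; the quotient above
   it keeps the bound [b.+1] with one variable fewer outside. *)
apply: (@linq_mon_trans _ _ (fun m => (b < mdeg m)%N && var_up (x |: V) m)).
- by apply: upset_mdeg; apply: upset_var_up.
- rewrite -[b.+1]/(1 + b)%N -(mdeg1 x); apply: linq_mon_shift (IHb V) => [|m|m].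
  + by apply: upset_mdeg; apply: upset_var_up.
  + by rewrite var_up_addl // mdegD mdeg1.
  + rewrite var_upU1 mdeg1 andb_orr; case: (boolP (_ <= m)%MM) => xm;
      last by rewrite andbF.
    suff -> : mdeg m = (mdeg (m - U_(x))%MM).+1 by rewrite /= ltnS andbT.
    by rewrite -{1}(submK xm) mdegD mdeg1 addn1.
- apply: IH; rewrite (cardsD1 x) inE xV in ltV.
  by rewrite setCU setIC -setDE.
Qed.

(** * Monomial generators and graded components *)

Definition div_up (s : seq mon) : pred mon :=
  fun m => has (fun u => u <= m)%MM s.

Lemma upset_div_up s : upset (div_up s).
Proof.
move=> m m' mm' /hasP[u us um]; apply/hasP; exists u => //.
exact: lepm_trans um mm'.
Qed.

Lemma ideal_gen_monomials (A : S -> Prop) U : upset U ->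
  (forall q, A q -> exists2 u, U u & q = 'X_[u]) ->
  (forall m, U m -> exists2 u, A 'X_[u] & (u <= m)%MM) ->
  same_set (ideal_gen A) (mon_ideal U).
Proof.
move=> upU AU UA p; split.
  apply: ideal_gen_sub => [||c g /AU[u Uu ->]]; first exact: mon_ideal0.
    exact: mon_idealD.
  by apply: mon_idealM => //; apply/mon_idealX.
move: p; apply: mon_ideal_ind => [||c m /UA[u Au um]]; first exact: ideal_gen0.
  exact: ideal_genD.
by rewrite -(submK um) mpolyXD -mul_mpolyC mulrA; apply: mem_ideal_gen.
Qed.

Lemma monomial_gen_seq (s : seq mon) :
  same_set (monomial_gen (fun u => u \in s)) (mon_ideal (div_up s)).
Proof.
apply: ideal_gen_monomials => [|q [u us ->]|m /hasP[u us um]].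
- exact: upset_div_up.
- by exists u => //; apply/hasP; exists u; rewrite ?lepm_refl.
- by exists u => //; exists u.
Qed.

Lemma var_ideal_mon (V : {set 'I_n}) :
  same_set (var_ideal V) (mon_ideal (var_up V)).
Proof.
apply: ideal_gen_monomials => [|q [k kV ->]|m /exists_inP[k kV km]].
- exact: upset_var_up.
- by exists U_(k)%MM => //; apply/exists_inP; exists k; rewrite ?lepm_refl.
- by exists U_(k)%MM => //; exists k.
Qed.

(** If [u] divided [v] properly, deleting [v] would leave a generating set. *)
Lemma minimal_generators_antichain (I : S -> Prop) s u v :
  minimal_generators I s -> u \in s -> v \in s -> (u <= v)%MM -> u = v.
Proof.
move=> [_ Is min] us vs uv; apply/eqP/negP => /negP neq_uv.
have := min (filter (predC1 v) s) (mem_subseq (filter_subseq _ _)).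
suff gen : same_set I (monomial_gen (fun w => w \in filter (predC1 v) s)).
  by move=> /(_ gen v vs); rewrite mem_filter /= eqxx.
move=> p; rewrite Is !monomial_gen_seq; split=> sp m /sp /hasP[w ws wm].
  apply/hasP; have [wv|wv] := eqVneq w v.
    exists u; first by rewrite mem_filter /= neq_uv.
    by apply: lepm_trans uv _; rewrite -wv.
  by exists w; rewrite // mem_filter /= wv.
by apply/hasP; exists w => //; move: ws; rewrite mem_filter => /andP[].
Qed.

Lemma lem_mdeg_eq (m m' : mon) :
  (m <= m')%MM -> (mdeg m' <= mdeg m)%N -> m = m'.
Proof.
move=> le_mm'; rewrite -{1 2}(submK le_mm') mdegD -[X in (_ <= X)%N]add0n.
by rewrite leq_add2r leqn0 mdeg_eq0 => /eqP->; rewrite add0m.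
Qed.

Lemma lem_interpolate (u m : mon) a :
  (u <= m)%MM -> (mdeg u <= a <= mdeg m)%N ->
  exists v, [/\ (u <= v)%MM, (v <= m)%MM & mdeg v = a].
Proof.
move=> um /andP[ua am]; rewrite -(subnKC ua) in am *; move: (a - _)%N am => b.
elim: b => [|b IHb] bm.
  by exists u; rewrite lepm_refl um addn0.
have [|v [uv vm dv]] := IHb; first by apply: leq_trans bm; rewrite addnS.
have /existsP[k vk] : [exists k, (v k < m k)%N].
  apply: contraLR bm; rewrite negb_exists => /forallP mv.
  rewrite addnS -dv -leqNgt !mdegE; apply: leq_sum => k _.
  by rewrite leqNgt mv.
exists (U_(k) + v)%MM; split.
- by apply: lepm_trans uv _; rewrite lem_addl.
- apply/mnm_lepP=> i; rewrite mnmDE mnm1E.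
  by case: (k =P i) => [<-|_]; rewrite ?add0n; first exact: vk; apply/mnm_lepP.
- by rewrite mdegD mdeg1 dv addnS.
Qed.

(** Exponents of the component ideal in degree [a]; applied to prefixes of the generator list, it
    yields the filtration. *)
Definition div_up_le a s : pred mon :=
  fun m => (a <= mdeg m)%N && div_up [seq u <- s | (mdeg u <= a)%N] m.

(** A generator of degree at most [a] and a multiple of it of degree at least [a] have a monomial of
    degree exactly [a] between them. *)
Lemma component_ideal_mon (I : S -> Prop) s a :
  same_set I (mon_ideal (div_up s)) ->
  same_set (component_ideal I a) (mon_ideal (div_up_le a s)).
Proof.
move=> IE p; have upU : upset (div_up_le a s).
  exact/upset_mdeg/upset_div_up.
split.
  apply: ideal_gen_sub => [||c q [/IE Iq hq]]; first exact: mon_ideal0.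
    exact: mon_idealD.
  apply: mon_idealM => // m mq; have dm := dhomog_mf hq mq.
  rewrite /in_mem /= /div_up_le dm leqnn; have /hasP[u us um] := Iq m mq.
  apply/hasP; exists u => //; rewrite mem_filter us andbT -dm.
  exact: lem_mdeg.
move: p; apply: mon_ideal_ind => [||c m]; first exact: ideal_gen0.
  exact: ideal_genD.
case/andP=> am /hasP[u]; rewrite mem_filter => /andP[ua us] um.
have [|v [uv vm dv]] := lem_interpolate um (a := a); first by rewrite ua.
rewrite -(submK vm) mpolyXD -mul_mpolyC mulrA; apply: mem_ideal_gen.
split; last by rewrite dhomogX; apply/eqP.
by apply/IE/mon_idealX/hasP; exists u.
Qed.

(** * Filtration of a component along linear quotients *)

Lemma linear_quotients_colon s :
  (forall i, (0 < i < size s)%N -> exists V : {set 'I_n},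
     same_set (colon (monomial_gen (fun u => u \in take i s))
                     'X_[K, nth 0%MM s i])
              (var_ideal V)) ->
  forall i, (i < size s)%N -> exists V : {set 'I_n},
    forall m, div_up (take i s) (nth 0%MM s i + m)%MM = var_up V m.
Proof.
move=> lq [|i] lti.
  (* For the first generator the colon of the zero ideal is zero, hence the empty set of
     variables. *)
  exists set0 => m; rewrite take0; apply/esym/exists_inP=> -[k].
  by rewrite inE.
have [V VE] := lq i.+1 lti; exists V => m; have := VE 'X_[m].
rewrite /colon -mpolyXD monomial_gen_seq var_ideal_mon !mon_idealX addmC.
by move=> E; apply/idP/idP=> /E.
Qed.

(* If [x_k] lies in the colon ideal of [u], some earlier [v] divides [x_k u];
   by minimality [v] is not [x_k u], so [mdeg v <= mdeg u]: discarding the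
   generators of degree greater than [a] does not change this colon ideal. *)
Lemma colon_bounded_degree (I : S -> Prop) s a i (V : {set 'I_n}) :
  minimal_generators I s -> (i < size s)%N ->
  (forall m, div_up (take i s) (nth 0%MM s i + m)%MM = var_up V m) ->
  (mdeg (nth 0%MM s i) <= a)%N ->
  forall m, div_up [seq u <- take i s | (mdeg u <= a)%N]
              (nth 0%MM s i + m)%MM = var_up V m.
Proof.
move=> min lti VE; set u := nth _ _ _ in VE * => ua m.
apply/idP/idP=> [/hasP[v]|/exists_inP[k kV km]].
  rewrite mem_filter => /andP[_ vs] vum; rewrite -VE.
  by apply/hasP; exists v.
have : div_up (take i s) (u + U_(k))%MM.
  by rewrite VE; apply/exists_inP; exists k; rewrite ?lepm_refl.
case/hasP=> v vs vuk; apply/hasP; exists v; last first.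
  apply: lepm_trans vuk _; apply/mnm_lepP=> j; rewrite !mnmDE leq_add2l.
  exact/mnm_lepP.
rewrite mem_filter vs andbT; apply: leq_trans ua; rewrite leqNgt.
apply/negP => uv; have vE : v = (u + U_(k))%MM.
  by apply: lem_mdeg_eq vuk _; rewrite mdegD mdeg1 addn1.
have uE : u = v.
  apply: (minimal_generators_antichain min); first exact: mem_nth.
    exact: mem_take vs.
  by rewrite vE lem_addr.
by rewrite uE ltnn in uv.
Qed.

Lemma linq_div_up_le (I : S -> Prop) s a : minimal_generators I s ->
  (forall i, (i < size s)%N -> exists V : {set 'I_n},
    forall m, div_up (take i s) (nth 0%MM s i + m)%MM = var_up V m) ->
  linq_mon a (div_up_le a s) pred0.
Proof.
move=> min colonE; rewrite -[s]take_size.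
elim: {-2}(size s) (leqnn (size s)) => [|i IHi] lti.
  rewrite take0; apply: eq_linq_mon (linq_mon_refl a pred0) => // m.
  by rewrite /div_up_le andbF.
have /IHi{IHi} IHi : (i <= size s)%N by exact: ltnW.
have [V VE] := colonE i lti.
rewrite /div_up_le (take_nth 0%MM lti) filter_rcons.
(* A generator of degree above [a] leaves the filtration unchanged. Otherwise the new quotient is
   S/(V), truncated at [a] minus the degree of the generator, then multiplied by that generator. *)
case: leqP => [ua|//]; apply: (linq_mon_trans _ IHi) => //.
rewrite -{1}(subnKC ua).
apply: linq_mon_shift (linq_mdeg (a - mdeg (nth 0%MM s i)) V) => [|m|m].
- exact/upset_mdeg/upset_div_up.
- by rewrite /div_up_le (colon_bounded_degree min lti VE ua) mdegD leq_subLR.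
rewrite /div_up_le /div_up has_rcons andb_orr orbC; congr (_ || _).
rewrite andbC; case: (boolP (_ <= _)%MM) => //= um.
by rewrite leq_subLR -mdegD addmC submK.
Qed.

End MonomialIdeals.

Theorem corollary2p8 (K : fieldType) (n : nat) (I : {mpoly K[n]} -> Prop)
    (monI : monomial_ideal I) (lqI : linear_quotients I) :
  componentwise_linear I.
Proof.
case: lqI => s min lq a _; have [_ genI _] := min.
have IE : same_set I (mon_ideal (div_up s)).
  by move=> p; rewrite genI monomial_gen_seq.
apply: linq_linear_resolution.
apply: eq_linq (linq_div_up_le a min (linear_quotients_colon lq)) => p.
  by rewrite (component_ideal_mon _ IE).
exact: mon_ideal_pred0.
Qed.
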